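(* Let $(\mathcal B,\mathbb E,\mathfrak s)$ be an extriangulated category and let $((\mathcal S,\mathcal T),(\mathcal U,\mathcal V))$ be any twin cotorsion pair on $\mathcal B$. Then its heart $\underline{\mathcal H}$ is semi-abelian.
   Context: Extriangulated category $(\mathcal B,\mathbb E,\mathfrak s)$: (ET1) $\mathcal B$ is an additive category and $\mathbb E\colon\mathcal B^{\mathrm{op}}\times\mathcal B\to \mathrm{Ab}$ is an additive bifunctor; for $\delta\in\mathbb E(C,A)$, $a\colon A\to A'$, $c\colon C'\to C$ write $a_*\delta=\mathbb E(C,a)(\delta)$ and $c^*\delta=\mathbb E(c,A)(\delta)$. Sequences $A\to B\to C$ and $A\to B'\to C$ are equivalent if there is an isomorphism $B\cong B'$ compatible with the identities of $A$ and $C$. $\mathfrak s$ assigns to each $\delta\in\mathbb E(C,A)$ an equivalence class $\mathfrak s(\delta)=[A\xrightarrow{x}B\xrightarrow{y}C]$; we say $A\xrightarrow{x}B\xrightarrow{y}C$ realizes $\delta$. (ET2) $\mathfrak s$ is an additive realization: if $A\xrightarrow{x}B\xrightarrow{y}C$ realizes $\delta$, $A'\xrightarrow{x'}B'\xrightarrow{y'}C'$ realizes $\delta'$ and $a\colon A\to A'$, $c\colon C\to C'$ satisfy $a_*\delta=c^*\delta'$, then there is $b\colon B\to B'$ with $bx=x'a$, $y'b=cy$; $0\in\mathbb E(C,A)$ is realized by the split sequence $A\to A\oplus C\to C$; and $\mathfrak s(\delta\oplus\delta')=\mathfrak s(\delta)\oplus\mathfrak s(\delta')$. (ET3) If $A\xrightarrow{x}B\xrightarrow{y}C$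 realizes $\delta\in\mathbb E(C,A)$, $A'\xrightarrow{x'}B'\xrightarrow{y'}C'$ realizes $\delta'\in\mathbb E(C',A')$ and $a\colon A\to A'$, $b\colon B\to B'$ satisfy $bx=x'a$, then there is $c\colon C\to C'$ with $cy=y'b$ and $a_*\delta=c^*\delta'$; and (ET3)$^{\mathrm{op}}$, its dual. (ET4) If $\delta\in\mathbb E(D,A)$ and $\delta'\in\mathbb E(F,B)$ are realized by $A\xrightarrow{f}B\xrightarrow{f'}D$ and $B\xrightarrow{g}C\xrightarrow{g'}F$, there are an object $E$, morphisms $d\colon D\to E$, $e\colon E\to F$, $h'\colon C\to E$ with $h'g=df'$, $eh'=g'$, and $\delta''\in\mathbb E(E,A)$ realized by $A\xrightarrow{gf}C\xrightarrow{h'}E$, such that $D\xrightarrow{d}E\xrightarrow{e}F$ realizes $f'_*\delta'$, $d^*\delta''=\delta$ and $f_*\delta''=e^*\delta'$; and (ET4)$^{\mathrm{op}}$, its dual. A conflation $A\rightarrowtail B\twoheadrightarrow C$ is a sequence realizing some $\delta\in\mathbb E(C,A)$. For full subcategories $\mathcal X,\mathcal Y\subseteq\mathcal B$: $\mathrm{Cone}(\mathcal X,\mathcal Y)$ is the full subcategory of objects $B$ admitting a conflation $X\rightarrowtail Y\twoheadrightarrow B$, and $\mathrm{CoCone}(\mathcal X,\mathcal Y)$ that of objects $B$ admitting a conflation $B\rightarrowtail X\twoheadrightarrow Y$, with $X\in\mathcal X$, $Y\in\mathcal Y$. A cotorsion pair $(\mathcal U,\mathcal V)$ on $\mathcal B$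 is a pair of full additive subcategories closed under direct summands and isomorphisms with $\mathbb E(\mathcal U,\mathcal V)=0$ and such that every $B\in\mathcal B$ admits conflations $V_B\rightarrowtail U_B\twoheadrightarrow B$ and $B\rightarrowtail V^B\twoheadrightarrow U^B$ with $U_B,U^B\in\mathcal U$, $V_B,V^B\in\mathcal V$. A twin cotorsion pair $((\mathcal S,\mathcal T),(\mathcal U,\mathcal V))$ is a pair of cotorsion pairs with $\mathbb E(\mathcal S,\mathcal V)=0$ (equivalently $\mathcal S\subseteq\mathcal U$). Put $\mathcal W=\mathcal T\cap\mathcal U$, $\mathcal B^+=\mathrm{Cone}(\mathcal V,\mathcal W)$, $\mathcal B^-=\mathrm{CoCone}(\mathcal W,\mathcal S)$, $\mathcal H=\mathcal B^+\cap\mathcal B^-$. The heart is $\underline{\mathcal H}=\mathcal H/\mathcal W$, the full subcategory on the objects of $\mathcal H$ of the quotient $\underline{\mathcal B}=\mathcal B/\mathcal W$ (ideal quotient by morphisms factoring through objects of $\mathcal W$). An additive category is preabelian if every morphism has a kernel and a cokernel. A preabelian category is left semi-abelian if in any pull-back diagram with $\mathbf a\colon A\to B$, $\mathbf b\colon A\to C$, $\mathbf c\colon B\to D$, $\mathbf d\colon C\to D$, $\mathbf{ca}=\mathbf{db}$, the morphism $\mathbf a$ is an epimorphism whenever $\mathbf d$ is a cokernel morphism; right semi-abelian is the dual notion; semi-abelian means both left and right semi-abelian. *)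

(* Defs.v *)
From HB Require Import structures.
From mathcomp Require Import all_boot all_algebra.
From mathcomp Require Import generic_quotient ring_quotient.
From mathcomp Require Import mathcomp_extra boolp classical_sets.

Set Implicit Arguments.
Unset Strict Implicit.
Unset Printing Implicit Defensive.

Import GRing.Theory.
Import Quotient.Exports.
Local Open Scope ring_scope.
Local Open Scope classical_set_scope.
Local Open Scope quotient_scope.

(* Hom-groups are [zmodType]s; the choice structure this carries is no
   restriction in the presence of the axioms of [boolp] ([gen_choiceMixin]).  *)
Record preadditive := Preadditive {
  obj :> Type;
  hom : obj -> obj -> zmodType;
  idm : forall A, hom A A;
  comp : forall A B C, hom B C -> hom A B -> hom A C;
  compA : forall A B C D (h : hom C D) (g : hom B C) (f : hom A B),
    comp h (comp g f) = comp (comp h g) f;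
  comp1m : forall A B (f : hom A B), comp (idm B) f = f;
  compm1 : forall A B (f : hom A B), comp f (idm A) = f;
  compDl : forall A B C (g g' : hom B C) (f : hom A B),
    comp (g + g') f = comp g f + comp g' f;
  compDr : forall A B C (g : hom B C) (f f' : hom A B),
    comp g (f + f') = comp g f + comp g f'
}.

Arguments hom {p} A B.
Arguments idm {p} A.
Arguments comp {p A B C} g f.

Notation "g \oc f" := (comp g f) (at level 40, left associativity).

Section Morphisms.
Variable C : preadditive.
Implicit Types A B D K Q X P : C.

Definition is_iso A B (f : hom A B) : Prop :=
  exists g : hom B A, g \oc f = idm A /\ f \oc g = idm B.

Definition isomorphic A B : Prop := exists f : hom A B, is_iso f.

Definition mono A B (f : hom A B) : Prop :=
  forall X (g h : hom X A), f \oc g = f \oc h -> g = h.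

Definition epi A B (f : hom A B) : Prop :=
  forall X (g h : hom B X), g \oc f = h \oc f -> g = h.

Definition is_kernel K A B (k : hom K A) (f : hom A B) : Prop :=
  f \oc k = 0 /\
  forall X (g : hom X A), f \oc g = 0 -> exists! h : hom X K, k \oc h = g.

Definition is_cokernel A B Q (f : hom A B) (q : hom B Q) : Prop :=
  q \oc f = 0 /\
  forall X (g : hom B X), g \oc f = 0 -> exists! h : hom Q X, h \oc q = g.

Definition kernel_morphism K A (k : hom K A) : Prop :=
  exists B (f : hom A B), is_kernel k f.

Definition cokernel_morphism B Q (q : hom B Q) : Prop :=
  exists A (f : hom A B), is_cokernel f q.

(*   A --a--> B
     |b       |c
     v        v
     C --d--> D   *)
Definition is_pullback A B C' D (a : hom A B) (b : hom A C')
    (c : hom B D) (d : hom C' D) : Prop :=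
  c \oc a = d \oc b /\
  forall X (u : hom X B) (v : hom X C'), c \oc u = d \oc v ->
    exists! h : hom X A, a \oc h = u /\ b \oc h = v.

Definition is_pushout A B C' D (a : hom A B) (b : hom A C')
    (c : hom B D) (d : hom C' D) : Prop :=
  c \oc a = d \oc b /\
  forall X (u : hom B X) (v : hom C' X), u \oc a = v \oc b ->
    exists! h : hom D X, h \oc c = u /\ h \oc d = v.

Definition is_zero A : Prop :=
  (forall X (f g : hom X A), f = g) /\ (forall X (f g : hom A X), f = g).

Record biproduct A B := Biproduct {
  bip :> C;
  in1 : hom A bip;
  in2 : hom B bip;
  pr1 : hom bip A;
  pr2 : hom bip B;
  pr1in1 : pr1 \oc in1 = idm A;
  pr2in2 : pr2 \oc in2 = idm B;
  pr1in2 : pr1 \oc in2 = 0;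
  pr2in1 : pr2 \oc in1 = 0;
  bip_id : in1 \oc pr1 + in2 \oc pr2 = idm bip
}.

Definition hom_sum A A' B B' (P : biproduct A A') (Q : biproduct B B')
    (f : hom A B) (f' : hom A' B') : hom P Q :=
  in1 Q \oc f \oc pr1 P + in2 Q \oc f' \oc pr2 P.

End Morphisms.

Definition additive_cat (C : preadditive) : Prop :=
  (exists Z : C, is_zero Z) /\ (forall A B : C, inhabited (biproduct A B)).

Definition preabelian (C : preadditive) : Prop :=
  additive_cat C /\
  forall (A B : C) (f : hom A B),
    (exists (K : C) (k : hom K A), is_kernel k f) /\
    (exists (Q : C) (q : hom B Q), is_cokernel f q).

Definition left_semi_abelian (C : preadditive) : Prop :=
  preabelian C /\
  forall (A B C' D : C) (a : hom A B) (b : hom A C')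
    (c : hom B D) (d : hom C' D),
    is_pullback a b c d -> cokernel_morphism d -> epi a.

Definition right_semi_abelian (C : preadditive) : Prop :=
  preabelian C /\
  forall (A B C' D : C) (a : hom A B) (b : hom A C')
    (c : hom B D) (d : hom C' D),
    is_pushout a b c d -> kernel_morphism a -> mono d.

Definition semi_abelian (C : preadditive) : Prop :=
  left_semi_abelian C /\ right_semi_abelian C.

(* A full subcategory is given by its set of objects. *)
Section FullSubcategory.
Variables (C : preadditive) (X : set C).

Definition fullsub : preadditive :=
  @Preadditive {A : C | X A} (fun A B => hom (sval A) (sval B))
    (fun A => idm (sval A)) (fun A B D g f => g \oc f)
    (fun A B D E h g f => compA h g f)
    (fun A B f => comp1m f) (fun A B f => compm1 f)
    (fun A B D g g' f => compDl g g' f)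
    (fun A B D g f f' => compDr g f f').

Definition closed_iso : Prop :=
  forall A B : C, isomorphic A B -> X A -> X B.

Definition closed_summand : Prop :=
  forall (A B : C) (P : biproduct A B), X P -> X A /\ X B.

End FullSubcategory.

Section Preadditive.
Variable C : preadditive.
Implicit Types A B D : C.

Lemma comp0m A B D (f : hom A B) : (0 : hom B D) \oc f = 0.
Proof. by apply: (addrI (0 \oc f)); rewrite -compDl !addr0. Qed.

Lemma compm0 A B D (g : hom B D) : g \oc (0 : hom A B) = 0.
Proof. by apply: (addrI (g \oc 0)); rewrite -compDr !addr0. Qed.

Lemma compNm A B D (g : hom B D) (f : hom A B) : (- g) \oc f = - (g \oc f).
Proof. by apply: (addrI (g \oc f)); rewrite -compDl !subrr comp0m. Qed.

Lemma compmN A B D (g : hom B D) (f : hom A B) : g \oc (- f) = - (g \oc f).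
Proof. by apply: (addrI (g \oc f)); rewrite -compDr !subrr compm0. Qed.

Lemma compBl A B D (g g' : hom B D) (f : hom A B) :
  (g - g') \oc f = g \oc f - g' \oc f.
Proof. by rewrite compDl compNm. Qed.

Lemma compBr A B D (g : hom B D) (f f' : hom A B) :
  g \oc (f - f') = g \oc f - g \oc f'.
Proof. by rewrite compDr compmN. Qed.

Lemma bip_isomorphic A B (P Q : biproduct A B) : isomorphic P Q.
Proof.
have inv (P1 P2 : biproduct A B) :
  (in1 P1 \oc pr1 P2 + in2 P1 \oc pr2 P2)
    \oc (in1 P2 \oc pr1 P1 + in2 P2 \oc pr2 P1) = idm P1.
  rewrite compDl !compDr -!compA !(compA (pr1 P2)) !(compA (pr2 P2)).
  rewrite pr1in1 pr2in2 pr1in2 pr2in1 !comp0m !compm0 !comp1m addr0 add0r.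
  exact: bip_id.
by exists (in1 Q \oc pr1 P + in2 Q \oc pr2 P),
  (in1 P \oc pr1 Q + in2 P \oc pr2 Q); rewrite !inv.
Qed.

End Preadditive.

Section FactorIdeal.
Variables (C : preadditive) (W : set C) (addW : additive_cat (fullsub W)).
Implicit Types A B D E : C.

Definition factors_through A B (f : hom A B) : Prop :=
  exists (P : C) (g : hom A P) (h : hom P B), W P /\ f = h \oc g.

(* The otherwise unused hypothesis is what lets unification find the instance of
   [zmodClosed] below. *)
Definition factor_ideal of additive_cat (fullsub W) := fun A B =>
  [pred f : hom A B | `[< factors_through f >]].

Lemma factor_idealP A B (f : hom A B) :
  reflect (factors_through f) (f \in factor_ideal addW A B).
Proof. exact: asboolP. Qed.

Lemma factor_ideal_zmod A B : zmod_closed (factor_ideal addW A B).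
Proof.
have [[[Z WZ] _] dsW] := addW; split=> [|f g].
  by apply/asboolP; exists Z, 0, 0; rewrite comp0m.
move=> /asboolP[P [f1 [f2 [WP ->]]]] /asboolP[Q [g1 [g2 [WQ ->]]]].
have [S] := dsW (exist _ P WP) (exist _ Q WQ).
apply/asboolP; exists (sval (bip S)).
pose i1 : hom P (sval (bip S)) := in1 S; pose i2 : hom Q (sval (bip S)) := in2 S.
pose p1 : hom (sval (bip S)) P := pr1 S; pose p2 : hom (sval (bip S)) Q := pr2 S.
have e11 : p1 \oc i1 = idm P := pr1in1 S.
have e22 : p2 \oc i2 = idm Q := pr2in2 S.
have e12 : p1 \oc i2 = 0 := pr1in2 S.
have e21 : p2 \oc i1 = 0 := pr2in1 S.
exists (i1 \oc f1 + i2 \oc g1), (f2 \oc p1 - g2 \oc p2).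
split; first exact: svalP.
rewrite compBl !compDr -!compA !(compA p1) !(compA p2) e11 e12 e21 e22.
by rewrite !comp1m !comp0m !compm0 addr0 add0r.
Qed.

HB.instance Definition _ A B :=
  GRing.isZmodClosed.Build _ (factor_ideal addW A B) (factor_ideal_zmod A B).

Lemma factor_ideal_compl A B D (g : hom B D) (f : hom A B) :
  f \in factor_ideal addW A B -> g \oc f \in factor_ideal addW A D.
Proof.
move=> /asboolP[P [f1 [f2 [WP ->]]]]; apply/asboolP.
by exists P, f1, (g \oc f2); rewrite compA.
Qed.

Lemma factor_ideal_compr A B D (g : hom B D) (f : hom A B) :
  g \in factor_ideal addW B D -> g \oc f \in factor_ideal addW A D.
Proof.
move=> /asboolP[P [g1 [g2 [WP ->]]]]; apply/asboolP.
by exists P, (g1 \oc f), g2; rewrite compA.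
Qed.

Definition qhom A B : zmodType := {ideal_quot (factor_ideal addW A B)}.

Definition qpi A B (f : hom A B) : qhom A B :=
  \pi_{ideal_quot (factor_ideal addW A B)} f.

Lemma qpiP A B (f g : hom A B) : qpi f = qpi g <-> factors_through (f - g).
Proof.
split=> [/eqP|fg]; last apply/eqP.
  by rewrite -Quotient.idealrBE => /factor_idealP.
by rewrite -Quotient.idealrBE; apply/factor_idealP.
Qed.

Lemma qpi_surj A B (f : qhom A B) : exists f0 : hom A B, f = qpi f0.
Proof. by exists (repr f); rewrite /qpi reprK. Qed.

Lemma qpiD A B (f g : hom A B) : qpi (f + g) = qpi f + qpi g.
Proof. exact: raddfD. Qed.

Definition qcomp A B D (g : qhom B D) (f : qhom A B) : qhom A D :=
  qpi (repr g \oc repr f).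

Lemma qcompE A B D (g : hom B D) (f : hom A B) :
  qcomp (qpi g) (qpi f) = qpi (g \oc f).
Proof.
apply/qpiP/factor_idealP; set g' := repr _; set f' := repr _.
have Ig : g' - g \in factor_ideal addW B D.
  by rewrite Quotient.idealrBE /g' /qpi reprK.
have If : f' - f \in factor_ideal addW A B.
  by rewrite Quotient.idealrBE /f' /qpi reprK.
have -> : g' \oc f' - g \oc f = (g' - g) \oc f' + g \oc (f' - f).
  by rewrite compBl compBr addrA subrK.
by apply: rpredD; [apply: factor_ideal_compr|apply: factor_ideal_compl].
Qed.

Lemma qcompA A B D E (h : qhom D E) (g : qhom B D) (f : qhom A B) :
  qcomp h (qcomp g f) = qcomp (qcomp h g) f.
Proof.
have [h0 ->] := qpi_surj h; have [g0 ->] := qpi_surj g; have [f0 ->] := qpi_surj f.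
by rewrite !qcompE compA.
Qed.

Lemma qcomp1m A B (f : qhom A B) : qcomp (qpi (idm B)) f = f.
Proof. by have [f0 ->] := qpi_surj f; rewrite qcompE comp1m. Qed.

Lemma qcompm1 A B (f : qhom A B) : qcomp f (qpi (idm A)) = f.
Proof. by have [f0 ->] := qpi_surj f; rewrite qcompE compm1. Qed.

Lemma qcompDl A B D (g g' : qhom B D) (f : qhom A B) :
  qcomp (g + g') f = qcomp g f + qcomp g' f.
Proof.
have [g0 ->] := qpi_surj g; have [h0 ->] := qpi_surj g'; have [f0 ->] := qpi_surj f.
by rewrite -qpiD !qcompE compDl qpiD.
Qed.

Lemma qcompDr A B D (g : qhom B D) (f f' : qhom A B) :
  qcomp g (f + f') = qcomp g f + qcomp g f'.
Proof.
have [g0 ->] := qpi_surj g; have [h0 ->] := qpi_surj f; have [f0 ->] := qpi_surj f'.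
by rewrite -qpiD !qcompE compDr qpiD.
Qed.

Definition quotient_cat : preadditive :=
  Preadditive qcompA qcomp1m qcompm1 qcompDl qcompDr.

End FactorIdeal.

Record tseq (C : preadditive) (A D : C) := TSeq {
  mid : C;
  infl : hom A mid;
  defl : hom mid D
}.

Definition tseq_equiv (C : preadditive) (A D : C) (q q' : tseq A D) : Prop :=
  exists b : hom (mid q) (mid q'),
    [/\ is_iso b, b \oc infl q = infl q' & defl q' \oc b = defl q].

Definition tseq_sum (C : preadditive) (A D A' D' : C)
    (q : tseq A D) (q' : tseq A' D') (PA : biproduct A A')
    (PB : biproduct (mid q) (mid q')) (PD : biproduct D D') : tseq PA PD :=
  TSeq (hom_sum PA PB (infl q) (infl q')) (hom_sum PB PD (defl q) (defl q')).

(* [ext C A] is E(C, A), with first argument the contravariant one; [push a d]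
   and [pull c d] are a_* d and c^* d. [realize d] is the set of the sequences
   that belong to the class s(d). *)
Record extri_data := ExtriData {
  ext_base :> preadditive;
  ext : ext_base -> ext_base -> zmodType;
  push : forall C A A' : ext_base, hom A A' -> {additive ext C A -> ext C A'};
  pull : forall C C' A : ext_base, hom C' C -> {additive ext C A -> ext C' A};
  realize : forall C A : ext_base, ext C A -> set (tseq A C)
}.

Arguments ext {e} C A.
Arguments push {e C A A'} a.
Arguments pull {e C C' A} c.
Arguments realize {e C A} d.

Section ExtriAxioms.
Variable B : extri_data.
Implicit Types A C D E F X Y Z : B.

Record additive_bifunctor : Prop := AdditiveBifunctor {
  push_id : forall C A (d : ext C A), push (idm A) d = d;
  push_comp : forall C A A' A'' (a' : hom A' A'') (a : hom A A') (d : ext C A),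
    push (a' \oc a) d = push a' (push a d);
  pull_id : forall C A (d : ext C A), pull (idm C) d = d;
  pull_comp : forall C C' C'' A (c : hom C' C) (c' : hom C'' C') (d : ext C A),
    pull (c \oc c') d = pull c' (pull c d);
  push_pull : forall C C' A A' (a : hom A A') (c : hom C' C) (d : ext C A),
    push a (pull c d) = pull c (push a d);
  pushDl : forall C A A' (a a' : hom A A') (d : ext C A),
    push (a + a') d = push a d + push a' d;
  pullDl : forall C C' A (c c' : hom C' C) (d : ext C A),
    pull (c + c') d = pull c d + pull c' d
}.

Definition ET1 : Prop := additive_cat B /\ additive_bifunctor.

Definition realize_class : Prop :=
  forall C A (d : ext C A),
    exists q0 : tseq A C, forall q, realize d q <-> tseq_equiv q0 q.

Definition realize_morphism : Prop :=
  forall C A C' A' (d : ext C A) (d' : ext C' A')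
    (q : tseq A C) (q' : tseq A' C') (a : hom A A') (c : hom C C'),
    realize d q -> realize d' q' -> push a d = pull c d' ->
    exists b : hom (mid q) (mid q'),
      b \oc infl q = infl q' \oc a /\ defl q' \oc b = c \oc defl q.

Definition realize_split : Prop :=
  forall A C (P : biproduct A C),
    realize (0 : ext C A) (TSeq (in1 P) (pr2 P)).

(* the element with components (d, 0, 0, d') of
   E(C (+) C', A (+) A') = E(C,A) (+) E(C,A') (+) E(C',A) (+) E(C',A') *)
Definition ext_sum C A C' A' (PC : biproduct C C') (PA : biproduct A A')
    (d : ext C A) (d' : ext C' A') : ext PC PA :=
  push (in1 PA) (pull (pr1 PC) d) + push (in2 PA) (pull (pr2 PC) d').

(* Both sides are equivalence classes, hence equal once they share a member. *)
Definition realize_sum : Prop :=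
  forall C A C' A' (d : ext C A) (d' : ext C' A')
    (q : tseq A C) (q' : tseq A' C') (PA : biproduct A A')
    (PB : biproduct (mid q) (mid q')) (PC : biproduct C C'),
    realize d q -> realize d' q' ->
    realize (ext_sum PC PA d d') (tseq_sum PA PB PC).

Definition ET2 : Prop :=
  [/\ realize_class, realize_morphism, realize_split & realize_sum].

Definition ET3 : Prop :=
  forall C A C' A' (d : ext C A) (d' : ext C' A')
    (q : tseq A C) (q' : tseq A' C') (a : hom A A') (b : hom (mid q) (mid q')),
    realize d q -> realize d' q' -> b \oc infl q = infl q' \oc a ->
    exists c : hom C C', c \oc defl q = defl q' \oc b /\ push a d = pull c d'.

Definition ET3op : Prop :=
  forall C A C' A' (d : ext C A) (d' : ext C' A')
    (q : tseq A C) (q' : tseq A' C') (b : hom (mid q) (mid q')) (c : hom C C'),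
    realize d q -> realize d' q' -> c \oc defl q = defl q' \oc b ->
    exists a : hom A A', b \oc infl q = infl q' \oc a /\ push a d = pull c d'.

(*   A --f--> X --f'-> D
     ||       |g       |d
     A -gf--> C --h'-> E
              |g'      |e
              F ====== F   *)
Definition ET4 : Prop :=
  forall A X C D F (f : hom A X) (f' : hom X D) (g : hom X C) (g' : hom C F)
    (dl : ext D A) (dl' : ext F X),
    realize dl (TSeq f f') -> realize dl' (TSeq g g') ->
    exists E (d : hom D E) (e : hom E F) (h' : hom C E) (dl'' : ext E A),
      [/\ h' \oc g = d \oc f', e \oc h' = g' &
          realize dl'' (TSeq (g \oc f) h')] /\
      [/\ realize (push f' dl') (TSeq d e), pull d dl'' = dl &
          push f dl'' = pull e dl'].

(*   F ====== F
     |e       |g'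
     E --h'-> C --fg-> A
     |d       |g       ||
     D --f'-> X --f--> A   *)
Definition ET4op : Prop :=
  forall A X C D F (f : hom X A) (f' : hom D X) (g : hom C X) (g' : hom F C)
    (dl : ext A D) (dl' : ext X F),
    realize dl (TSeq f' f) -> realize dl' (TSeq g' g) ->
    exists E (d : hom E D) (e : hom F E) (h' : hom E C) (dl'' : ext A E),
      [/\ g \oc h' = f' \oc d, h' \oc e = g' &
          realize dl'' (TSeq h' (f \oc g))] /\
      [/\ realize (pull f' dl') (TSeq e d), push d dl'' = dl &
          pull f dl'' = push e dl'].

End ExtriAxioms.

Record extriangulated := Extriangulated {
  extri :> extri_data;
  extri_ET1 : ET1 extri;
  extri_ET2 : ET2 extri;
  extri_ET3 : ET3 extri;
  extri_ET3op : ET3op extri;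
  extri_ET4 : ET4 extri;
  extri_ET4op : ET4op extri
}.

Section CotorsionPairs.
Variable B : extriangulated.
Implicit Types S T U V X Y : set B.

Definition conflation (A M C : B) (x : hom A M) (y : hom M C) : Prop :=
  exists d : ext C A, realize d (TSeq x y).

Definition Cone X Y : set B := [set M | exists (P Q : B) (x : hom P Q)
  (y : hom Q M), [/\ X P, Y Q & conflation x y]].

Definition CoCone X Y : set B := [set M | exists (P Q : B) (x : hom M P)
  (y : hom P Q), [/\ X P, Y Q & conflation x y]].

Definition ext_vanish X Y : Prop :=
  forall P Q : B, X P -> Y Q -> forall d : ext P Q, d = 0.

Record cotorsion_pair U V : Prop := CotorsionPair {
  cp_addl : additive_cat (fullsub U);
  cp_addr : additive_cat (fullsub V);
  cp_isol : closed_iso U;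
  cp_isor : closed_iso V;
  cp_suml : closed_summand U;
  cp_sumr : closed_summand V;
  cp_vanish : ext_vanish U V;
  cp_cone : forall M : B, exists (P Q : B) (x : hom P Q) (y : hom Q M),
    [/\ V P, U Q & conflation x y];
  cp_cocone : forall M : B, exists (P Q : B) (x : hom M P) (y : hom P Q),
    [/\ V P, U Q & conflation x y]
}.

Record twin_cotorsion_pair S T U V : Prop := TwinCotorsionPair {
  twin_fst : cotorsion_pair S T;
  twin_snd : cotorsion_pair U V;
  twin_vanish : ext_vanish S V
}.

End CotorsionPairs.

Section Heart.
Variables (B : extriangulated) (S T U V : set B).

Definition coreW : set B := T `&` U.
Definition Bplus : set B := Cone V coreW.
Definition Bminus : set B := CoCone coreW S.
Definition heart_objects : set B := Bplus `&` Bminus.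

Lemma additive_coreW : twin_cotorsion_pair S T U V ->
  additive_cat (fullsub coreW).
Proof.
have bip_of (X : set B) (P Q : B) (XP : X P) (XQ : X Q) :
    additive_cat (fullsub X) -> exists R : biproduct P Q, X R.
  case=> _ /(_ (exist _ P XP) (exist _ Q XQ)) [R].
  by exists (@Biproduct B P Q (sval (bip R)) (in1 R) (in2 R) (pr1 R) (pr2 R)
    (pr1in1 R) (pr2in2 R) (pr1in2 R) (pr2in1 R) (bip_id R)); exact: svalP.
move=> [[_ addT _ isoT _ _ _ _ _] [addU _ isoU _ _ _ _ _ _] _].
split=> [|[P [TP UP]] [Q [TQ UQ]]].
- have [[Z TZ] [/= Z1 Z2]] := addT.1; have [[Z' UZ'] [/= Z'1 Z'2]] := addU.1.
  have zZ (D : B) (f g : hom D Z) : f = g.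
    rewrite -(comp1m f) -(comp1m g); have -> : idm Z = 0 by exact: (Z1 (exist _ Z TZ)).
    by rewrite !comp0m.
  have zZ' (D : B) (f g : hom D Z') : f = g.
    rewrite -(comp1m f) -(comp1m g).
    have -> : idm Z' = 0 by exact: (Z'1 (exist _ Z' UZ')).
    by rewrite !comp0m.
  have UZ : U Z by apply: isoU UZ'; exists 0, 0; split; [exact: zZ'|exact: zZ].
  exists (exist _ Z (conj TZ UZ)); split=> [D f g|[D WD] f g]; first exact: zZ.
  rewrite -(compm1 f) -(compm1 g) /=.
  by rewrite [idm Z](zZ _ _ 0) !compm0.
- have [R TR] := bip_of T P Q TP TQ addT; have [R' UR'] := bip_of U P Q UP UQ addU.
  have UR : U R by apply: isoU UR'; exact: bip_isomorphic.
  by constructor; exact: (@Biproduct (fullsub coreW) (exist _ P (conj TP UP))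
    (exist _ Q (conj TQ UQ)) (exist _ (bip R) (conj TR UR)) (in1 R) (in2 R)
    (pr1 R) (pr2 R) (pr1in1 R) (pr2in2 R) (pr1in2 R) (pr2in1 R) (bip_id R)).
Qed.

(* The hypothesis makes the ideal of morphisms factoring through W an additive
   subgroup of each hom-group, as the formation of B/W requires. *)
Definition heart (twin : twin_cotorsion_pair S T U V) : preadditive :=
  @fullsub (quotient_cat (additive_coreW twin)) heart_objects.

End Heart.

(* Main.v *)
From mathcomp Require Import all_boot ssralg.
From mathcomp Require Import classical_sets.
Require Import Defs.

Set Implicit Arguments.
Unset Strict Implicit.
Unset Printing Implicit Defensive.

Import GRing.Theory.
Local Open Scope ring_scope.
Local Open Scope classical_set_scope.

(** The heart is treated as a reflective and coreflective piece of B/W.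

    The objects Y of [Bminus] are exactly those for which every morphism to an
    object of T kills every extension by an object of V ([BminusP]).  This
    criterion makes [Bminus] stable under cones of inflations with third term
    in S.  For such Y the two cotorsion pairs and (ET4) yield a conflation
    Y -> Y+ -> S0 with S0 in S and Y+ in the heart, along which every morphism
    to an object of [Bplus] extends ([reflection]); moreover a morphism from Y+
    to an object of [Bplus] vanishes in B/W as soon as its restriction to Y
    does ([throughW_cancel_infl], which holds for any inflation with third term
    in S).

    Cokernels: for f : A -> Y in the heart choose A -> R -> S0 with R in W and
    S0 in S, push this conflation out along f to Y -> M -> S0, and reflect M.
    The composite Y -> M -> M+ is a cokernel of f in the heart, and it is
    itself an inflation with third term in S ([heart_cokernel]).

    Left semi-abelian: by uniqueness of cokernels one may take the cokernel
    d : C -> D of a pull-back square to be such an inflation, with third term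
    Q in S.  Given c : Y -> D, a deflation R -> D with R in W makes
    Y (+) R -> D a deflation, and (ET4)^op completes the composite
    Y (+) R -> D -> Q to a conflation X -> Y (+) R -> Q together with a map
    X -> C.  Here X lies in [Bminus], and X -> Y is an epimorphism of B/W as
    far as targets in [Bplus] are concerned, because Q is in S and R is in W.
    Its reflection maps to the pull-back, so X+ -> Y factors through the
    projection to Y, which is therefore an epimorphism ([pullback_cover],
    [model_pullback]).

    Kernels and the right half follow by duality.  The opposite of B is
    extriangulated and the roles of (S,T,U,V) become (V,U,T,S), but the heart
    of the opposite is not literally the opposite of the heart, its hom-groups
    being quotients by another predicate.  Hence the categorical part is proved
    for any category presented by the heart objects of B and their morphisms
    modulo W ([heart_model]); the opposite of the heart is one such category for
    the opposite of B. *)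

(** * Duality *)

Definition op_pre (C : preadditive) : preadditive :=
  @Preadditive C (fun A B => hom B A) (fun A => idm A)
    (fun A B D g f => f \oc g)
    (fun A B D E h g f => esym (compA f g h))
    (fun A B f => compm1 f) (fun A B f => comp1m f)
    (fun A B D g g' f => compDr f g g')
    (fun A B D g f f' => compDl f f' g).

Definition op_bip (C : preadditive) (A B : C) (P : biproduct A B) :
    @biproduct (op_pre C) A B :=
  @Biproduct (op_pre C) A B (bip P) (pr1 P) (pr2 P) (in1 P) (in2 P)
    (pr1in1 P) (pr2in2 P) (pr2in1 P) (pr1in2 P) (bip_id P).

Definition unop_bip (C : preadditive) (A B : C)
    (P : @biproduct (op_pre C) A B) : biproduct A B :=
  @Biproduct C A B (bip P) (pr1 P) (pr2 P) (in1 P) (in2 P)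
    (pr1in1 P) (pr2in2 P) (pr2in1 P) (pr1in2 P) (bip_id P).

Definition swap_bip (C : preadditive) (A B : C) (P : biproduct A B) :
    biproduct B A :=
  @Biproduct C B A (bip P) (in2 P) (in1 P) (pr2 P) (pr1 P)
    (pr2in2 P) (pr1in1 P) (pr2in1 P) (pr1in2 P)
    (etrans (addrC _ _) (bip_id P)).

Lemma op_additive (C : preadditive) : additive_cat C -> additive_cat (op_pre C).
Proof.
case=> -[Z [Z1 Z2]] bips; split; first by exists Z; split; [exact: Z2|exact: Z1].
by move=> A B; have [P] := bips A B; constructor; exact: op_bip.
Qed.

Definition op_tseq (C : preadditive) (A D : C)
    (q : @tseq (op_pre C) A D) : tseq D A := TSeq (C := C) (defl q) (infl q).

Definition op_data (B : extri_data) : extri_data :=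
  @ExtriData (op_pre B) (fun C A => ext A C)
    (fun C A A' a => pull a) (fun C C' A c => push c)
    (fun C A d q => realize d (op_tseq q)).

Section OpAxioms.
Variable B : extriangulated.

Lemma op_ET1 : ET1 (op_data B).
Proof.
have [addB [pi_ pc li lc pp pD lD]] := extri_ET1 B.
split; first exact: op_additive.
split=> //=.
- by move=> *; exact: li.
- by move=> *; exact: lc.
- by move=> *; exact: pi_.
- by move=> *; exact: pc.
- by move=> *; symmetry; exact: pp.
- by move=> *; exact: lD.
- by move=> *; exact: pD.
Qed.

Lemma op_realize_class : realize_class (op_data B).
Proof.
move=> C A d; have [cl _ _ _] := extri_ET2 B.
have [[M x y] Mq] := cl A C d.
exists (@TSeq (op_pre B) A C M y x) => -[N y' x'].
apply: (iff_trans (Mq (TSeq (C := B) x' y'))).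
split=> -[/= b [[b' [b1 b2]] bu vb]]; exists b'; split=> /=.
- by exists b.
- by rewrite -vb -compA b2 compm1.
- by rewrite -bu compA b1 comp1m.
- by exists b.
- by rewrite -vb [LHS](@compA B) (b2 : @comp B _ _ _ b' b = idm _) comp1m.
- by rewrite -bu -[LHS](@compA B) (b1 : @comp B _ _ _ b b' = idm _) compm1.
Qed.

Lemma op_ET2 : ET2 (op_data B).
Proof.
have [cl mor split_ sum] := extri_ET2 B.
have [_ [_ _ _ _ pp _ _]] := extri_ET1 B.
split; first exact: op_realize_class.
- move=> C A C' A' d d' q q' a c qd qd' /= ac.
  by have [b [b1 b2]] := mor _ _ _ _ _ _ _ _ c a qd' qd (esym ac); exists b.
- by move=> A C P; exact: (split_ C A (swap_bip (unop_bip P))).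
- move=> C A C' A' d d' q q' PA PB PC qd qd'.
  have := sum A C A' C' d d' (op_tseq q) (op_tseq q') (unop_bip PC)
    (unop_bip PB) (unop_bip PA) qd qd'.
  by rewrite /= /ext_sum /tseq_sum /op_tseq /hom_sum /= !pp !compA.
Qed.

Lemma op_ET3 : ET3 (op_data B).
Proof.
move=> C A C' A' d d' q q' a b qd qd' /= e.
have [c [c1 c2]] := @extri_ET3op B _ _ _ _ d' d (op_tseq q') (op_tseq q) b a
  qd' qd (esym e).
by exists c.
Qed.

Lemma op_ET3op : ET3op (op_data B).
Proof.
move=> C A C' A' d d' q q' b c qd qd' /= e.
have [a [a1 a2]] := @extri_ET3 B _ _ _ _ d' d (op_tseq q') (op_tseq q) c b
  qd' qd (esym e).
by exists a.
Qed.

Definition op_extri : extriangulated :=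
  @Extriangulated (op_data B) op_ET1 op_ET2 op_ET3 op_ET3op
    (@extri_ET4op B) (@extri_ET4 B).

End OpAxioms.

(** * Exact sequences attached to a conflation *)

Section Exactness.
Variable B : extriangulated.
Implicit Types A C D E F M X Y Z : B.

Lemma bip_ex A C : inhabited (biproduct A C).
Proof. by have [[_ bips] _] := extri_ET1 B. Qed.

Lemma zero_ex : exists Z : B, is_zero Z.
Proof. by have [[z _] _] := extri_ET1 B. Qed.

(** An object is its own biproduct with a zero object, so that the conflations
    A = A -> 0 and 0 -> A = A are instances of the split realization. *)
Definition bip0 A Z (Z0 : is_zero Z) : biproduct A Z :=
  @Biproduct B A Z A (idm A) 0 (idm A) 0 (comp1m _) (proj1 Z0 _ _ _)
    (compm0 _ _) (proj1 Z0 _ _ _)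
    (etrans (congr2 +%R (comp1m _) (comp0m _ _)) (addr0 _)).

Lemma realization C A (d : ext C A) :
  exists M (x : hom A M) (y : hom M C), realize d (TSeq x y).
Proof.
have [cl _ _ _] := extri_ET2 B; have [[M x y] Mq] := cl C A d.
exists M, x, y; apply/Mq; exists (idm M).
by split; rewrite /= ?comp1m ?compm1 //; exists (idm M); rewrite comp1m.
Qed.

(** The condition [push f d = 0] says that (f, 1) is a morphism from d to the
    zero extension, whose realization is a split sequence; projecting a middle
    morphism to the first summand extends f. *)
Lemma infl_extends C A M (d : ext C A) (x : hom A M) (y : hom M C) :
  realize d (TSeq x y) -> forall Z (f : hom A Z), push f d = 0 ->
  exists g : hom M Z, f = g \oc x.
Proof.
move=> rd Z f fd; have [_ mor sp _] := extri_ET2 B.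
have [P] := bip_ex Z C.
have [|b [/= bx _]] := mor _ _ _ _ d 0 _ _ f (idm C) rd (sp Z C P).
  by rewrite fd raddf0.
by exists (pr1 P \oc b); rewrite -compA bx compA pr1in1 comp1m.
Qed.

Lemma realize_idl A Z : is_zero Z ->
  realize (0 : ext Z A) (TSeq (idm A) (0 : hom A Z)).
Proof.
by move=> Z0; have [_ _ sp _] := extri_ET2 B; exact: (sp A Z (bip0 A Z0)).
Qed.

Lemma realize_idr A Z : is_zero Z ->
  realize (0 : ext A Z) (TSeq (0 : hom Z A) (idm A)).
Proof.
move=> Z0; have [_ _ sp _] := extri_ET2 B.
exact: (sp Z A (swap_bip (bip0 A Z0))).
Qed.

(** (ET3) compares the sequence with M = M -> 0. *)
Lemma infl_push0 C A M (d : ext C A) (x : hom A M) (y : hom M C) :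
  realize d (TSeq x y) -> push x d = 0.
Proof.
move=> rd; have [Z Z0] := zero_ex.
have [//|c [_ ->]] := extri_ET3 (q := TSeq x y)
  (q' := TSeq (idm M) (0 : hom M Z)) (a := x) (b := idm M) rd
  (realize_idl M Z0).
by rewrite raddf0.
Qed.

(** (ET3) compares the sequence with 0 -> Z = Z, along h in the middle. *)
Lemma defl_factors C A M (d : ext C A) (x : hom A M) (y : hom M C) :
  realize d (TSeq x y) -> forall Z (h : hom M Z), h \oc x = 0 ->
  exists g : hom C Z, h = g \oc y.
Proof.
move=> rd Z h hx; have [O O0] := zero_ex.
have [|c [/= cy _]] := extri_ET3 (q := TSeq x y)
  (q' := TSeq (0 : hom O Z) (idm Z)) (a := 0) (b := h) rd
  (realize_idr Z O0).
  by rewrite /= hx compm0.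
by exists c; rewrite cy comp1m.
Qed.

(** Exactness of E(C,V) -> E(M,V) -> E(A,V) at the middle term.  Realize t by
    V -> N -> M; by (ET4)^op the composite N -> M -> C has a kernel part E, and
    V -> E -> A realizes the restriction of t to A.  When that is zero, V -> E
    has a retraction, along which the extension of C by E is pushed to t'. *)
Lemma ext_middle C A M V (d : ext C A) (x : hom A M) (y : hom M C)
    (t : ext M V) :
  realize d (TSeq x y) -> pull x t = 0 -> exists t' : ext C V, t = pull y t'.
Proof.
move=> rd xt0; have [N [v [p rt]]] := realization t.
have [_ [pid pc _ _ pp _ _]] := extri_ET1 B.
have [E [a [e [h [d2 [[_ _ _] [re _ d2t]]]]]]] := extri_ET4op rd rt.
have [r re1] : exists r, idm V = r \oc e.
  by apply: infl_extends re _ _ _; rewrite xt0 raddf0.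
by exists (push r d2); rewrite -pp d2t -pc -re1 pid.
Qed.

(** The biproduct changed by the automorphism of A (+) C that subtracts c from
    the second component: it turns (c, 1) : A (+) C -> C into a projection and
    hence a deflation. *)
Definition shear_bip A C (P : biproduct A C) (c : hom A C) : biproduct A C.
Proof.
refine (@Biproduct B A C (bip P) (in1 P - in2 P \oc c) (in2 P) (pr1 P)
  (c \oc pr1 P + pr2 P) _ _ _ _ _).
- by rewrite compBr compA pr1in1 pr1in2 comp0m subr0.
- by rewrite compDl -compA pr1in2 pr2in2 compm0 add0r.
- exact: pr1in2.
- rewrite compBr !compDl -!compA pr1in1 pr2in1 (compA (pr1 P)) (compA (pr2 P)).
  by rewrite pr1in2 pr2in2 comp0m compm0 compm1 comp1m addr0 add0r subrr.
- by rewrite compBl compDr -compA addrA subrK bip_id.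
Defined.

(** If y is a deflation, so is (c, y).  It is the composite of 1 (+) y, a sum
    of two deflations, and of the split deflation (c, 1), so that (ET4)^op
    applies. *)
Lemma deflation_pair A C D F (d : ext D F) (x : hom F C) (y : hom C D)
    (c : hom A D) (P : biproduct A C) :
  realize d (TSeq x y) -> exists E (h : hom E P) e,
  realize e (TSeq h (c \oc pr1 P + y \oc pr2 P)).
Proof.
move=> rd; have [_ _ sp sum] := extri_ET2 B; have [O O0] := zero_ex.
have [R] := bip_ex A D; have [K] := bip_ex O F.
have rs := sum _ _ _ _ 0 d (TSeq (0 : hom O A) (idm A)) (TSeq x y) K P R
  (realize_idr A O0) rd.
have [E [a [e [h [d2 [[_ _ rd2] _]]]]]] :=
  extri_ET4op (sp A D (shear_bip R c)) rs.
exists E, h, d2; move: rd2; congr (realize _ (TSeq _ _)).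
rewrite /= /hom_sum /= compm1 !compDl !compDr -!compA.
rewrite (compA (pr1 R)) (compA (pr2 R)) (compA (pr1 R)) (compA (pr2 R)).
by rewrite pr1in1 pr2in2 pr1in2 pr2in1 !comp0m !comp1m !compm0 !addr0 add0r.
Qed.

End Exactness.

Section ExactnessOp.
Variable B : extriangulated.
Implicit Types A C D E F M X Y Z : B.

(** Dual of [infl_extends]. *)
Lemma defl_lifts C A M (d : ext C A) (x : hom A M) (y : hom M C) :
  realize d (TSeq x y) -> forall Z (f : hom Z C), pull f d = 0 ->
  exists g : hom Z M, f = y \oc g.
Proof. by move=> rd; exact: (@infl_extends (op_extri B) A C M d y x). Qed.

End ExactnessOp.

(** * Cotorsion pairs *)

Section Cotorsion.
Variable B : extriangulated.
Implicit Types A C D E F M X Y Z : B.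

Lemma split_mid A C M (x : hom A M) (y : hom M C) (P : biproduct A C) :
  realize (0 : ext C A) (TSeq x y) -> isomorphic M P.
Proof.
move=> r0; have [cl _ sp _] := extri_ET2 B.
have [q0 q0P] := cl C A 0.
have [b [[b' [b'b bb']] _ _]] := (q0P _).1 r0.
have [c [[c' [c'c cc']] _ _]] := (q0P _).1 (sp A C P).
exists (c \oc b'), (b \oc c'); split.
  by rewrite -compA (compA c') c'c comp1m.
by rewrite -compA (compA b') b'b comp1m.
Qed.

Variables U V : set B.
Hypothesis cp : cotorsion_pair U V.

(** U is the left orthogonal of V: the conflation V0 -> U0 -> X splits, which
    makes X a direct summand of U0. *)
Lemma orth_left X : (forall P, V P -> forall d : ext X P, d = 0) -> U X.
Proof.
move=> X0; have [P [Q [x [y [VP UQ [d rd]]]]]] := cp_cone cp X.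
rewrite (X0 P VP d) in rd; have [R] := bip_ex P X.
have UR : U R := cp_isol cp (split_mid R rd) UQ.
exact: (cp_suml cp UR).2.
Qed.

Lemma left_extension C A M (d : ext C A) (x : hom A M) (y : hom M C) :
  realize d (TSeq x y) -> U A -> U C -> U M.
Proof.
move=> rd UA UC; apply: orth_left => P VP t.
have [|t' ->] := ext_middle rd (t := t); first exact: (cp_vanish cp UA VP).
by rewrite (cp_vanish cp UC VP t') raddf0.
Qed.

End Cotorsion.

Section OpTwin.
Variable B : extriangulated.
Implicit Types S T U V X : set B.

Lemma op_fullsub_additive X : additive_cat (fullsub X) ->
  additive_cat (@fullsub (op_extri B) X).
Proof. by move/op_additive. Qed.

Lemma op_closed_iso X : closed_iso X -> @closed_iso (op_extri B) X.
Proof.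
move=> iX P Q [f [g [gf fg]]]; apply: iX; exists g, f.
by split; [exact: gf|exact: fg].
Qed.

Lemma op_cotorsion U V :
  cotorsion_pair U V -> @cotorsion_pair (op_extri B) V U.
Proof.
case=> aU aV iU iV sU sV van cone cocone; split.
- exact: op_fullsub_additive.
- exact: op_fullsub_additive.
- exact: op_closed_iso.
- exact: op_closed_iso.
- by move=> P Q R; exact: (sV _ _ (unop_bip R)).
- by move=> P Q R; exact: (sU _ _ (unop_bip R)).
- by move=> P Q VP UQ d; exact: van.
- by move=> M; have [P [Q [x [y [VP UQ xy]]]]] := cocone M; exists Q, P, y, x.
- by move=> M; have [P [Q [x [y [VP UQ xy]]]]] := cone M; exists Q, P, y, x.
Qed.

(** Duality exchanges the two cotorsion pairs as well as the two halves of each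
    pair, and fixes the intersection of T and U. *)
Lemma op_twin S T U V : twin_cotorsion_pair S T U V ->
  @twin_cotorsion_pair (op_extri B) V U T S.
Proof.
case=> ST UV van; split; [exact: op_cotorsion|exact: op_cotorsion|].
by move=> P Q VP SQ d; exact: van.
Qed.

Lemma op_Bplus T U V Z : Bplus T U V Z <-> @Bminus (op_extri B) V U T Z.
Proof.
split=> -[P [Q [x [y []]]]].
  by move=> ? [? ?] ?; exists Q, P, y, x.
by case=> ? ? ? ?; exists Q, P, y, x.
Qed.

Lemma op_Bminus S T U Z : Bminus S T U Z <-> @Bplus (op_extri B) U T S Z.
Proof.
split=> -[P [Q [x [y []]]]].
  by case=> ? ? ? ?; exists Q, P, y, x.
by move=> ? [? ?] ?; exists Q, P, y, x.
Qed.

Lemma op_factors T U A C (f : hom A C) : factors_through (coreW T U) f <->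
  @factors_through (op_extri B) (coreW (B := op_extri B) U T) C A f.
Proof.
by split=> -[P [g [h [[WP1 WP2] ->]]]]; exists P, h, g.
Qed.

End OpTwin.

(** * The heart of a twin cotorsion pair *)

Section Twin.
Variable B : extriangulated.
Variables S T U V : set B.
Hypothesis twin : twin_cotorsion_pair S T U V.
Implicit Types A C D E F M X Y Z : B.
Let cpST := twin_fst twin.
Let cpUV := twin_snd twin.
Local Notation W := (coreW T U).
Local Notation throughW := (factors_through W).

Lemma S_sub_U : S `<=` U.
Proof.
by move=> P SP; apply: (orth_left cpUV) => Q VQ; exact: (twin_vanish twin SP VQ).
Qed.

Lemma throughW_add X Y (f g : hom X Y) :
  throughW f -> throughW g -> throughW (f + g).
Proof.
move=> /(factor_idealP (additive_coreW twin)) Wf.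
move=> /(factor_idealP (additive_coreW twin)) Wg.
by apply/(factor_idealP (additive_coreW twin)); exact: rpredD.
Qed.

Lemma throughW_compr X Y Z (g : hom Y Z) (f : hom X Y) :
  throughW g -> throughW (g \oc f).
Proof. by move=> [P [h [k [WP ->]]]]; exists P, (h \oc f), k; rewrite compA. Qed.

(** A criterion that involves no choice of a conflation.  If Y embeds in R in
    W with third term in S, a morphism from Y to an object of T extends
    to R, where all
    extensions by V vanish.  Conversely, embed Y in T0 in T with third term in
    S: an extension of T0 by V0 restricts to zero on Y, hence comes from
    E(S,V) = 0; so T0 is in U as well. *)
Lemma BminusP Y : Bminus S T U Y <->
  forall P Q (y : hom Y P) (d : ext P Q), T P -> V Q -> pull y d = 0.
Proof.
have [_ [_ _ _ lc _ _ _]] := extri_ET1 B.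
split=> [[R [Q0 [i [p [[TR UR] SQ0 [e re]]]]]] P Q y d TP VQ | Y0].
  have [g ->] := infl_extends re (cp_vanish cpST SQ0 TP (push y e)).
  by rewrite lc (cp_vanish cpUV UR VQ (pull g d)) raddf0.
have [P [Q [x [y [TP SQ [d rd]]]]]] := cp_cocone cpST Y.
exists P, Q, x, y; split=> //; last by exists d.
split=> //; apply: (orth_left cpUV) => V0 VV0 t.
have [|t' ->] := ext_middle rd (t := t); first exact: Y0.
by rewrite (twin_vanish twin SQ VV0 t') raddf0.
Qed.

Lemma Bminus_mid X Y Q (d : ext Q X) (x : hom X Y) (y : hom Y Q) :
  realize d (TSeq x y) -> S Q -> Bminus S T U X -> Bminus S T U Y.
Proof.
have [_ [_ _ _ lc _ _ _]] := extri_ET1 B.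
move=> rd SQ /BminusP X0; apply/BminusP => P V0 z t TP VV0.
have [|t' ->] := ext_middle rd (t := pull z t); first by rewrite -lc; exact: X0.
by rewrite (twin_vanish twin SQ VV0 t') raddf0.
Qed.

Lemma Bminus_infl X Y Q (d : ext Q X) (x : hom X Y) (y : hom Y Q) :
  realize d (TSeq x y) -> S Q -> Bminus S T U Y -> Bminus S T U X.
Proof.
move=> rd SQ [R [Q0 [i [p [WR SQ0 [e re]]]]]].
have [E [a [b [h [d2 [[_ _ rd2] [re2 _ _]]]]]]] := extri_ET4 rd re.
exists R, E, (i \oc x), h; split=> //; last by exists d2.
exact: (left_extension cpST re2 SQ SQ0).
Qed.

Lemma Bminus_bip X Y (P : biproduct X Y) :
  Bminus S T U X -> Bminus S T U Y -> Bminus S T U P.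
Proof.
have [_ [_ _ pid lc _ _ lD]] := extri_ET1 B.
move=> /BminusP X0 /BminusP Y0; apply/BminusP => Q R z t TQ VR.
rewrite -[pull z t]pid -(bip_id P) lD !lc -(lc _ _ _ _ z (in1 P)).
by rewrite -(lc _ _ _ _ z (in2 P)) X0 // Y0 // !raddf0 addr0.
Qed.

Lemma W_Bminus X : W X -> Bminus S T U X.
Proof.
by move=> [TX UX]; apply/BminusP => P Q z t TP VQ; exact: (cp_vanish cpUV UX VQ).
Qed.

(** Inflations with third term in S act as epimorphisms of B/W on targets in
    [Bplus]: if h x factors through P in W, the first factor extends along x
    since E(S,T) = 0, and the difference between h and the resulting morphism
    comes from a morphism Q -> Z, which lifts to the object of W that covers Z
    since E(S,V) = 0. *)
Lemma throughW_cancel_infl Y E Q Z (d : ext Q Y) (x : hom Y E) (y : hom E Q)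
    (h : hom E Z) :
  realize d (TSeq x y) -> S Q -> Bplus T U V Z -> throughW (h \oc x) ->
  throughW h.
Proof.
move=> rd SQ [V0 [R [i [w [VV0 WR [e re]]]]]] [P [f [k [WP hx]]]].
have [g fg] := infl_extends rd (cp_vanish cpST SQ WP.1 (push f d)).
have [|m hm] := defl_factors rd (h := h - k \oc g).
  by rewrite compBl hx fg compA subrr.
have [n mn] := defl_lifts re (twin_vanish twin SQ VV0 (pull m e)).
have -> : h = k \oc g + w \oc n \oc y by rewrite -mn -hm addrC subrK.
apply: throughW_add; first by exists P, g, k.
by apply: throughW_compr; exists R, n, w.
Qed.

End Twin.

Section Reflection.
Variable B : extriangulated.
Variables S T U V : set B.
Hypothesis twin : twin_cotorsion_pair S T U V.
Implicit Types A C D E F M X Y Z : B.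
Let cpST := twin_fst twin.
Let cpUV := twin_snd twin.
Local Notation W := (coreW T U).
Local Notation throughW := (factors_through W).
Local Notation H := (heart_objects S T U V).

(** Dual of [BminusP]. *)
Lemma BplusP Z : Bplus T U V Z <->
  forall P Q (z : hom P Z) (d : ext Q P), U P -> S Q -> push z d = 0.
Proof.
apply: (iff_trans (op_Bplus T U V Z)).
apply: (iff_trans (BminusP (op_twin twin) Z)).
by split=> Z0 P Q z d UP SQ; exact: Z0.
Qed.

Lemma Bplus_bip X Y (P : biproduct X Y) :
  Bplus T U V X -> Bplus T U V Y -> Bplus T U V P.
Proof.
move=> /op_Bplus BX /op_Bplus BY; apply/op_Bplus.
exact: (Bminus_bip (op_twin twin) (op_bip P) BX BY).
Qed.

Lemma heart_bip X Y (P : biproduct X Y) : H X -> H Y -> H P.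
Proof.
move=> [pX mX] [pY mY]; split; first exact: Bplus_bip.
exact: (Bminus_bip twin).
Qed.

Lemma heart_zero Z : is_zero Z -> H Z.
Proof.
have [_ [_ _ _ _ _ pD lD]] := extri_ET1 B.
move=> [Z1 Z2]; split.
  apply/BplusP => P Q z d _ _; rewrite (Z1 _ z 0).
  by apply: (addrI (push 0 d)); rewrite -pD !addr0.
apply/(BminusP twin) => P Q z d _ _; rewrite (Z2 _ z 0).
by apply: (addrI (pull 0 d)); rewrite -lD !addr0.
Qed.

(** The conflation Y -> E -> S0 is the push-out of U0 -> T0 -> S0 along
    u : U0 -> Y, so the obstruction to extending f : Y -> Z is the push of the
    latter extension along f u, which vanishes by [BplusP]. *)
Lemma reflection Y : Bminus S T U Y -> exists E (x : hom Y E) Q (y : hom E Q) d,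
  [/\ H E, S Q, realize d (TSeq x y) &
      forall Z (f : hom Y Z), Bplus T U V Z -> exists g, f = g \oc x].
Proof.
have [_ [_ pc _ _ _ _ _]] := extri_ET1 B.
move=> mY; have [V0 [U0 [v [u [VV0 UU0 [d rd]]]]]] := cp_cone cpUV Y.
have [T0 [S0 [t [s [TT0 SS0 [e re]]]]]] := cp_cocone cpST U0.
have [E [a [b [h [d2 [[_ _ rd2] [re2 _ _]]]]]]] := extri_ET4 rd re.
have UT0 : U T0 := left_extension cpUV re UU0 (S_sub_U twin SS0).
exists E, a, S0, b, (push u e); split=> // [|Z f /BplusP pZ].
  split; last exact: (Bminus_mid twin re2 SS0 mY).
  by exists V0, T0, (t \oc v), h; split=> //; exists d2.
by apply: infl_extends re2 _ _ _; rewrite -pc; exact: pZ.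
Qed.

(** The cone of the pushed-out inflation represents morphisms g with g f
    factoring through W: such a factorization can be moved to A -> R, so g
    kills the pushed extension and extends, on the nose and not only
    modulo W. *)
Lemma heart_cokernel A Y (f : hom A Y) :
  Bminus S T U A -> Bminus S T U Y ->
  exists D (c : hom Y D) Q (r : hom D Q) d,
  [/\ H D, S Q, realize d (TSeq c r), throughW (c \oc f) &
      forall Z (g : hom Y Z), Bplus T U V Z -> throughW (g \oc f) ->
      exists k, g = k \oc c].
Proof.
have [_ [_ pc _ _ _ _ _]] := extri_ET1 B.
have [_ mor _ _] := extri_ET2 B.
move=> [R [Q0 [i [p [WR SQ0 [e re]]]]]] mY.
have [M [j [q rM]]] := realization (push f e).
have [|b [/= bi _]] := mor _ _ _ _ e (push f e) _ _ f (idm Q0) re rM.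
  by have [_ [_ _ -> _ _ _ _]] := extri_ET1 B.
have mM : Bminus S T U M := Bminus_mid twin rM SQ0 mY.
have [D [x [Q [y [d [HD SQ rd refl]]]]]] := reflection mM.
have [E [a [c [h [d2 [[_ _ rd2] [re2 _ _]]]]]]] := extri_ET4 rM rd.
exists D, (x \oc j), E, h, d2; split=> //.
- exact: (left_extension cpST re2 SQ0 SQ).
- by exists R, i, (x \oc b); split=> //; rewrite -!compA bi.
move=> Z g pZ [P [k [l [WP gf]]]].
have [m km] := infl_extends re (cp_vanish cpST SQ0 WP.1 (push k e)).
have [|g' gg'] := infl_extends rM (f := g).
  by rewrite -pc gf km compA pc (infl_push0 re) raddf0.
have [k' gk'] := refl Z g' pZ.
by exists k'; rewrite compA -gk'.
Qed.

(** An approximation of the pull-back of c and x modulo W, large enough to see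
    that its projection to Y is an epimorphism. *)
Lemma pullback_cover Y C D Q (d : ext Q C) (x : hom C D) (r : hom D Q)
    (c : hom Y D) :
  realize d (TSeq x r) -> S Q -> H Y -> H C -> Bplus T U V D ->
  exists X (u : hom X Y) (v : hom X C),
  [/\ H X, throughW (c \oc u - x \oc v) &
      forall Z (k : hom Y Z), Bplus T U V Z -> throughW (k \oc u) -> throughW k].
Proof.
move=> rd SQ [pY mY] [pC mC] pD; have [V1 [R [i [w [VV1 WR [e re]]]]]] := pD.
have [P] := bip_ex Y R; have [F [j [t rt]]] := deflation_pair c P re.
(* X -> Y (+) R -> Q, where v0 : X -> C comes from the kernel of D -> Q. *)
have [X [v0 [a [h [d2 [[hv _ rd2] _]]]]]] := extri_ET4op rd rt.
have mP : Bminus S T U P := Bminus_bip twin P mY (W_Bminus twin WR).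
have mX : Bminus S T U X := Bminus_infl twin rd2 SQ mP.
have [E [y [Q' [z [d' [HE SQ' rd' refl]]]]]] := reflection mX.
have [u uy] := refl _ (pr1 P \oc h) pY; have [v vy] := refl _ v0 pC.
exists E, u, v; split=> // [|Z k pZ ku].
  apply: (throughW_cancel_infl twin rd' SQ' pD).
  exists R, (- (pr2 P \oc h)), w; split=> //.
  rewrite compBl -!compA -uy -vy -hv compDl compmN -!compA.
  by rewrite opprD addrA subrr add0r.
have : throughW (k \oc pr1 P).
  apply: (throughW_cancel_infl twin rd2 SQ pZ).
  by rewrite -compA uy compA; exact: throughW_compr.
by move/(throughW_compr (in1 P)); rewrite -compA pr1in1 compm1.
Qed.

End Reflection.

(** * Presentations of the heart *)

(** [Q] is the category of heart objects of [B] modulo W, up to the encoding of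
    objects and morphism classes: [under] gives the object of [B] behind an
    object of [Q], and [cls] the class of a morphism. *)
Record heart_model (B : extriangulated) (S T U V : set B) (Q : preadditive) :=
  HeartModel {
    under : Q -> B;
    under_heart : forall X, heart_objects S T U V (under X);
    under_surj : forall A, heart_objects S T U V A -> exists X, under X = A;
    cls : forall X Y, hom (under X) (under Y) -> hom X Y;
    cls_surj : forall X Y (f : hom X Y), exists f0, f = cls f0;
    cls_id : forall X, cls (idm (under X)) = idm X;
    cls_comp : forall X Y Z (g : hom (under Y) (under Z))
      (f : hom (under X) (under Y)), cls (g \oc f) = cls g \oc cls f;
    clsD : forall X Y (f g : hom (under X) (under Y)),
      cls (f + g) = cls f + cls g;
    cls_eq0 : forall X Y (f : hom (under X) (under Y)),
      cls f = 0 <-> factors_through (coreW T U) f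
  }.

Arguments cls {B S T U V Q} h {X Y} f.
Arguments cls_surj {B S T U V Q} h {X Y} f.
Arguments cls_id {B S T U V Q} h X.
Arguments cls_comp {B S T U V Q} h {X Y Z} g f.
Arguments clsD {B S T U V Q} h {X Y} f g.
Arguments cls_eq0 {B S T U V Q} h {X Y} f.

Definition heart_presents (B : extriangulated) (S T U V : set B)
    (twin : twin_cotorsion_pair S T U V) : heart_model S T U V (heart twin).
Proof.
exists (fun X : heart twin => sval X) (fun X Y f => qpi (additive_coreW twin) f).
- by move=> X; exact: svalP.
- by move=> A HA; exists (exist _ A HA).
- by move=> X Y f; exact: qpi_surj.
- by [].
- by move=> X Y Z g f; rewrite /= qcompE.
- by move=> X Y f g; exact: qpiD.
- move=> X Y f; have -> : (0 : hom X Y) = qpi (additive_coreW twin) 0.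
    by apply: (addrI (qpi (additive_coreW twin) 0)); rewrite -qpiD !addr0.
  by rewrite -[X in factors_through _ X]subr0; exact: qpiP.
Defined.

Definition op_model (B : extriangulated) (S T U V : set B) (Q : preadditive)
  (m : heart_model S T U V Q) :
  @heart_model (op_extri B) V U T S (op_pre Q).
Proof.
have opH A : heart_objects S T U V A <-> @heart_objects (op_extri B) V U T S A.
  split=> -[pA mA]; split.
  - exact: (op_Bminus S T U A).1.
  - exact: (op_Bplus T U V A).1.
  - exact: (op_Bplus T U V A).2.
  - exact: (op_Bminus S T U A).2.
refine (@HeartModel (op_extri B) V U T S (op_pre Q) (under m) _ _
  (fun X Y f => cls m f) _ _ _ _ _).
- by move=> X; apply/opH; exact: (under_heart m).
- by move=> A /opH HA; exact: (under_surj m HA).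
- by move=> X Y f; exact: (cls_surj m).
- exact: (cls_id m).
- by move=> X Y Z g f; exact: (cls_comp m f g).
- by move=> X Y f g; exact: (clsD m f g).
- move=> X Y f; apply: (iff_trans (cls_eq0 m f)).
  exact: op_factors.
Defined.

Section Model.
Variable B : extriangulated.
Variables S T U V : set B.
Hypothesis twin : twin_cotorsion_pair S T U V.
Variable Q : preadditive.
Variable m : heart_model S T U V Q.
Implicit Types X Y Z : Q.
Local Notation throughW := (factors_through (coreW T U)).

Lemma cls0 X Y : cls m (0 : hom (under m X) (under m Y)) = 0.
Proof. by apply: (addrI (cls m 0)); rewrite -clsD !addr0. Qed.

Lemma clsB X Y (f g : hom (under m X) (under m Y)) :
  cls m (f - g) = cls m f - cls m g.
Proof. by apply: (addIr (cls m g)); rewrite -clsD !subrK. Qed.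

Lemma model_additive : additive_cat Q.
Proof.
split.
  have [Z Z0] := zero_ex B; have [X eX] := under_surj m (heart_zero twin Z0).
  rewrite -eX in Z0; exists X; split=> Y f g.
    have [f0 ->] := cls_surj m f; have [g0 ->] := cls_surj m g.
    by rewrite (Z0.1 _ f0 g0).
  have [f0 ->] := cls_surj m f; have [g0 ->] := cls_surj m g.
  by rewrite (Z0.2 _ f0 g0).
move=> X Y; have [P] := bip_ex (under m X) (under m Y).
have := heart_bip twin P (under_heart m X) (under_heart m Y).
case: P => P i1 i2 p1 p2 e11 e22 e12 e21 eid /= /(under_surj m)[R eR].
subst P; constructor.
apply: (@Biproduct Q X Y R (cls m i1) (cls m i2) (cls m p1) (cls m p2)).
- by rewrite -cls_comp e11 cls_id.
- by rewrite -cls_comp e22 cls_id.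
- by rewrite -cls_comp e12 cls0.
- by rewrite -cls_comp e21 cls0.
- by rewrite -!cls_comp -clsD eid cls_id.
Qed.

(** Existence of cokernels, in the special form needed for pull-backs: some
    cokernel is the class of an inflation of B with third term in S. *)
Lemma model_cokernel X Y (f : hom X Y) :
  exists D (c : hom (under m Y) (under m D)) P (r : hom (under m D) P) d,
  [/\ S P, realize d (TSeq c r) & is_cokernel f (cls m c)].
Proof.
have [f0 ->] := cls_surj m f.
have [D [c [P [r [d [HD SP rd cf univ]]]]]] :=
  heart_cokernel twin f0 (under_heart m X).2 (under_heart m Y).2.
have [D' eD] := under_surj m HD; subst D.
exists D', c, P, r, d; split=> //; split=> [|Z g].
  by rewrite -cls_comp; apply/cls_eq0.
have [g0 ->] := cls_surj m g; rewrite -cls_comp => /cls_eq0 gf.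
have pZ := (under_heart m Z).1.
have [k gk] := univ _ g0 pZ gf.
exists (cls m k); split=> [|h]; first by rewrite -cls_comp -gk.
have [h0 ->] := cls_surj m h => hk.
apply/eqP; rewrite -subr_eq0 -clsB; apply/eqP/cls_eq0.
apply: (throughW_cancel_infl twin rd SP pZ).
by apply/cls_eq0; rewrite compBl clsB !cls_comp hk -cls_comp -gk subrr.
Qed.

(** The cover X of [pullback_cover] maps to the pull-back, so a morphism that
    vanishes on the pull-back vanishes on X, and hence on Y. *)
Lemma model_pullback X Y Z D (a : hom X Y) (b : hom X Z) (c : hom Y D)
    (d : hom Z D) :
  is_pullback a b c d -> cokernel_morphism d -> epi a.
Proof.
move=> [_ univ] [A [f [df cok]]].
have [D0 [d0 [P [r [e [SP re [d0f cok0]]]]]]] := model_cokernel f.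
have [phi [phid _]] := cok0 _ d df; have [psi [psid _]] := cok _ _ d0f.
(* d is only isomorphic to the class of the inflation d0, through phi and
   its inverse psi; the cover is built for psi c. *)
have phipsi : phi \oc psi = idm D.
  have [t [_ tu]] := cok _ d df.
  by rewrite -(tu (idm D)) ?comp1m // -(tu (phi \oc psi)) // -compA psid.
have [c0 ec] := cls_surj m (psi \oc c).
have [E [u [v [HE sq uepi]]]] := pullback_cover twin c0 re SP
  (under_heart m Y) (under_heart m Z) (under_heart m D0).1.
have [E' eE] := under_surj m HE; subst E.
have sqQ : c \oc cls m u = d \oc cls m v.
  rewrite -phid -compA -(comp1m c) -phipsi -(compA phi) -compA ec.
  congr (phi \oc _); rewrite -!cls_comp; apply/eqP.
  by rewrite -subr_eq0 -clsB; apply/eqP/cls_eq0.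
have [h [[ah _] _]] := univ _ _ _ sqQ.
move=> R k l ka; apply/eqP; rewrite -subr_eq0; apply/eqP.
have : (k - l) \oc a = 0 by rewrite compBl ka subrr.
have [n ->] := cls_surj m (k - l) => na.
apply/cls_eq0; apply: uepi; first exact: (under_heart m R).1.
by apply/cls_eq0; rewrite cls_comp -ah compA na comp0m.
Qed.

End Model.

Lemma model_semi_abelian (B : extriangulated) (S T U V : set B)
    (Q : preadditive) :
  twin_cotorsion_pair S T U V -> heart_model S T U V Q -> semi_abelian Q.
Proof.
move=> twin m; pose twin' := op_twin twin; pose m' := op_model m.
have pre : preabelian Q.
  split=> [|X Y f]; first exact: (model_additive twin m).
  split; first by have [K [k [_ [_ [_ [_ _ ?]]]]]] := model_cokernel twin' m' f;
    exists K, (cls m' k).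
  by have [K [k [_ [_ [_ [_ _ ?]]]]]] := model_cokernel twin m f;
    exists K, (cls m k).
split; split=> // A X Y Z a b c d; first exact: (model_pullback twin m).
move=> [sq univ] ka.
apply: (model_pullback twin' m' (X := Z) (Y := Y) (Z := X) (D := A)
  (a := d) (b := c) (c := b) (d := a)) ka; split=> [|R u v uv]; first exact: esym.
by have [h [[hc hd] hu]] := univ R v u (esym uv); exists h; split=> // h' [? ?];
   exact: hu.
Qed.

Theorem theorem2p32 (B : extriangulated) (S T U V : set B)
  (twin : twin_cotorsion_pair S T U V) : semi_abelian (heart twin).
Proof. exact: (model_semi_abelian twin (heart_presents twin)). Qed.
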